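(* Let $(X,d)$ be a metric space and $A$ and $B$ two nonempty subsets of $X$ such that $(A,B)$ satisfies property WUC. Assume that $A$ is complete. Let $T$ be a cyclic contraction on $A\cup B$. Then $T$ has a unique best proximity point $z$ in $A$, and the sequence $\{T^{2n}x\}$ converges to $z$ for every $x\in A$.
   Context: $\operatorname{dist}(A,B)=\inf\{d(x,y): x\in A,\ y\in B\}$. The pair $(A,B)$ has property WUC if every sequence $\{x_m\}\subseteq A$ with the following property is convergent (in $X$): for every $\varepsilon>0$ there exist $y\in B$ and $m_0\in\mathbb N$ such that $d(x_m,y)\le\operatorname{dist}(A,B)+\varepsilon$ for all $m\ge m_0$. $T:A\cup B\to A\cup B$ is a cyclic contraction if $T(A)\subseteq B$, $T(B)\subseteq A$, and there is $r\in(0,1)$ such that $d(Tx,Ty)\le r\,d(x,y)+(1-r)\operatorname{dist}(A,B)$ for all $x\in A$, $y\in B$. A point $x\in A\cup B$ is a best proximity point for $T$ if $d(x,Tx)=\operatorname{dist}(A,B)$. *)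

(* Defs.v *)
From mathcomp Require Import all_boot all_order all_algebra.
From mathcomp Require Import all_classical all_reals all_analysis.

Set Implicit Arguments.
Unset Strict Implicit.
Unset Printing Implicit Defensive.

Import Order.TTheory GRing.Theory Num.Theory.

Local Open Scope classical_set_scope.
Local Open Scope ring_scope.

(* [inf] is the greatest lower bound only for nonempty sets bounded below;
   distances are bounded below by 0, so [A] and [B] must be nonempty. *)
Definition set_dist (R : realType) (X : metricType R) (A B : set X) : R :=
  inf [set mdist x y | x in A & y in B].

Definition property_WUC (R : realType) (X : metricType R) (A B : set X) : Prop :=
  forall x : nat -> X,
    (forall m, A (x m)) ->
    (forall e : R, 0 < e ->
      exists2 y : X, B y &
        exists m0 : nat, forall m : nat, (m0 <= m)%N ->
          mdist (x m) y <= set_dist A B + e) ->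
    exists l : X, x @ \oo --> l.

Definition complete_subset (R : realType) (X : metricType R) (A : set X) : Prop :=
  forall x : nat -> X,
    (forall n, A (x n)) -> cauchy (x @ \oo) ->
    exists2 l : X, A l & x @ \oo --> l.

(* Only the values of [T] on [A `|` B] are constrained: outside that set,
   [T] is an arbitrary extension of a map defined on [A `|` B]. *)
Definition cyclic_contraction (R : realType) (X : metricType R) (A B : set X)
    (T : X -> X) : Prop :=
  [/\ T @` A `<=` B, T @` B `<=` A &
    exists r : R, 0 < r < 1 /\
      forall x y : X, A x -> B y ->
        mdist (T x) (T y) <= r * mdist x y + (1 - r) * set_dist A B].

Definition best_proximity_point (R : realType) (X : metricType R) (A B : set X)
    (T : X -> X) (x : X) : Prop :=
  (A `|` B) x /\ mdist x (T x) = set_dist A B.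

(* Main.v *)
(* Write D for dist(A, B) and e(x, y) = d(x, y) - D >= 0 for x in A, y in B.
   The contraction gives e(T^2 x, T^2 y) <= r^2 e(x, y).  Hence, for an orbit
   x_n = T^n x, the excesses e(x_{2k}, x_1) are bounded, and then
   e(x_{2m}, x_{2n+1}) <= r^{2n} e(x_{2(m-n)}, x_1) tends to 0 uniformly in
   m >= n.  Property WUC makes x_{2m} converge to some z, and e(z, Tz) = 0
   in the limit.  For uniqueness, WUC applied to the alternating sequence
   w, w', w, w', ... forces w = w' as soon as w and w' are both within
   distance D of the same point of B. *)
Require Import Defs.
From mathcomp Require Import all_boot all_order all_algebra.
From mathcomp Require Import all_classical all_reals all_analysis.
From mathcomp Require Import lra.

Set Implicit Arguments.
Unset Strict Implicit.

Local Open Scope classical_set_scope.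
Local Open Scope ring_scope.

Import Order.TTheory GRing.Theory Num.Theory.

Lemma set_dist_ge0 (R : realType) (X : metricType R) (A B : set X) :
  A !=set0 -> B !=set0 -> 0 <= set_dist A B.
Proof.
move=> [a Aa] [b Bb]; apply: lb_le_inf.
  by exists (mdist a b), a => //; exists b.
by move=> _ [x _ [y _ <-]]; exact: mdist_ge0.
Qed.

Lemma set_dist_le (R : realType) (X : metricType R) (A B : set X) (x y : X) :
  A x -> B y -> set_dist A B <= mdist x y.
Proof.
move=> Ax By; apply: ge_inf; last by exists x => //; exists y.
by exists 0 => _ [? _ [? _ <-]]; exact: mdist_ge0.
Qed.

Lemma cvg_mdistP (R : realType) (X : metricType R) (u : nat -> X) (l : X) :
  u @ \oo --> l <->
  forall e : R, 0 < e ->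
    exists N : nat, forall m : nat, (N <= m)%N -> mdist l (u m) < e.
Proof.
split=> [/metricType_numDomainType.cvgrPdist_lt ul e e0|ul].
  by have [N _ uN] := ul e e0; exists N => m /uN.
apply/metricType_numDomainType.cvgrPdist_lt => e e0.
by have [N uN] := ul e e0; exists N.
Qed.

Lemma property_WUC_unique (R : realType) (X : metricType R) (A B : set X)
    (w w' y : X) :
  property_WUC A B -> A w -> A w' -> B y ->
  mdist w y <= set_dist A B -> mdist w' y <= set_dist A B -> w = w'.
Proof.
move=> AB Aw Aw' By wy w'y.
have [||l] := AB (fun n => if odd n then w else w').
- by move=> m; case: ifP.
- move=> e e0; exists y => //; exists 0%N => m _; case: ifP => _.
    by apply: le_trans wy _; rewrite lerDl ltW.
  by apply: le_trans w'y _; rewrite lerDl ltW.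
move=> /cvg_mdistP ul; apply: mdist_positivity.
apply/eqP; rewrite eq_le mdist_ge0 andbT; apply/ler_addgt0Pl => e e0.
(* The terms of index [2N] and [2N+1] are [w'] and [w]; both indices are at least [N], so both
   points lie within [e / 2] of [l]. *)
have [N uN] := ul (e / 2) (divr_gt0 e0 (ltr0n _ 2)).
have := uN N.*2 (leq_trans (leq_addr _ _) (eq_leq (addnn N))).
have := uN N.*2.+1 (leqW (leq_trans (leq_addr _ _) (eq_leq (addnn N)))).
rewrite /= odd_double /= => lw lw'; have := metric_triangle w l w'.
rewrite (metric_sym w l); lra.
Qed.

Lemma cyclic_contraction_even (R : realType) (X : metricType R) (A B : set X)
    (T : X -> X) (n : nat) (x : X) :
  cyclic_contraction A B T ->
  (A x -> A (iter (2 * n) T x)) /\ (B x -> B (iter (2 * n) T x)).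
Proof.
move=> [TA TB _]; elim: n => [//|n [IA IB]]; rewrite mulnS /=; split=> Hx.
  apply: (TB _ (ex_intro2 _ _ (T _) _ erefl)).
  exact: (TA _ (ex_intro2 _ _ _ (IA Hx) erefl)).
apply: (TA _ (ex_intro2 _ _ (T _) _ erefl)).
exact: (TB _ (ex_intro2 _ _ _ (IB Hx) erefl)).
Qed.

Lemma cyclic_contraction_iter (R : realType) (X : metricType R) (A B : set X)
    (T : X -> X) :
  cyclic_contraction A B T ->
  exists q : R, 0 < q < 1 /\
    forall (n : nat) (x y : X), A x -> B y ->
      mdist (iter (2 * n) T x) (iter (2 * n) T y) - set_dist A B
        <= q ^+ n * (mdist x y - set_dist A B).
Proof.
move=> cT; have [TA TB [r [/andP[r0 r1] Tr]]] := cT.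
(* Only even iterates keep each point on its own side, so one induction step uses the contraction
   twice and costs [r * r]. *)
exists (r * r); split.
  by rewrite mulr_gt0 //= mulr_ilt1 // ltW.
elim=> [|n IH] x y Ax By; first by rewrite expr0 mul1r.
have [Ax' _] := cyclic_contraction_even n x cT.
have [_ By'] := cyclic_contraction_even n y cT.
rewrite mulnS /= exprS -mulrA.
move: (IH x y Ax By) (Ax' Ax) (By' By).
set a := iter _ T x; set b := iter _ T y => ab Aa Bb.
have h1 := Tr _ _ Aa Bb.
(* The second use has the sides exchanged: [T b] is in [A] and [T a] in [B], hence the symmetry
   rewrites. *)
have h2 := Tr _ _ (TB _ (ex_intro2 _ _ _ Bb erefl))
                  (TA _ (ex_intro2 _ _ _ Aa erefl)).
rewrite metric_sym (metric_sym (T b)) in h2.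
have h3 : r * (mdist (T a) (T b) - set_dist A B) <=
    r * (r * (mdist a b - set_dist A B)).
  by apply: ler_wpM2l; lra.
apply: (@le_trans _ _ (r * r * (mdist a b - set_dist A B))); first by lra.
by apply: ler_wpM2l => //; rewrite mulr_ge0 // ltW.
Qed.

Lemma cyclic_contraction_orbit (R : realType) (X : metricType R) (A B : set X)
    (T : X -> X) (x : X) :
  cyclic_contraction A B T -> A x ->
  forall e : R, 0 < e -> exists N : nat, forall n m : nat,
    (N <= n)%N -> (n <= m)%N ->
    mdist (iter (2 * m) T x) (iter (2 * n) T (T x)) <= set_dist A B + e.
Proof.
move=> cT Ax e e0; have [TA TB _] := cT.
have BTx : B (T x) by apply: TA; exists x.
have [q [/andP[q0 q1] Tq]] := cyclic_contraction_iter cT.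
pose D := set_dist A B; pose y := T x; pose y' := iter (2 * 1) T y.
(* By the triangle inequality through [y'], the excess over [D] at [k+1] is at most [q] times the
   excess at [k] plus [mdist y' y]. The choice of [E] gives [E = q * E + mdist y' y + mdist x y], so
   the bound [E] propagates; the term [mdist x y] covers [k = 0]. *)
pose E := (mdist y' y + mdist x y) / (1 - q).
have D0 : 0 <= D := set_dist_ge0 (ex_intro _ x Ax) (ex_intro _ _ BTx).
have EE : mdist y' y + mdist x y = E * (1 - q).
  by rewrite divfK // gt_eqF // subr_gt0.
have E0 : 0 <= E by rewrite divr_ge0 ?subr_ge0 ?(ltW q1) // addr_ge0 // mdist_ge0.
have bounded k : mdist (iter (2 * k) T x) y - D <= E.
  elim: k => [|k IH] /=.
    by have := mdist_ge0 y' y; have := mulr_ge0 E0 (ltW q0); lra.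
  have Ak := (cyclic_contraction_even k x cT).1 Ax.
  have := Tq 1%N _ _ Ak BTx; rewrite expr1 -iterD -mulnDr add1n -/y' -/D.
  have := metric_triangle (iter (2 * k.+1) T x) y' y.
  have := ler_wpM2l (ltW q0) IH; have := mdist_ge0 x y.
  rewrite -/y; lra.
have nq1 : `|q| < 1 by rewrite gtr0_norm.
have /cvgrPdist_lt /(_ e e0) [N _ HN] := cvg_geometric E nq1.
exists N => n m Nn nm.
have := HN n Nn; rewrite /geometric /= sub0r normrN => HE.
have Amn := (cyclic_contraction_even (m - n) x cT).1 Ax.
have := Tq n _ _ Amn BTx; rewrite -iterD -mulnDr subnKC // -/D.
have := ler_wpM2l (exprn_ge0 n (ltW q0)) (bounded (m - n)%N).
have := ler_norm (E * q ^+ n); rewrite -/y; lra.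
Qed.

Lemma cyclic_contraction_cvg (R : realType) (X : metricType R) (A B : set X)
    (T : X -> X) (x : X) :
  property_WUC A B -> complete_subset A -> cyclic_contraction A B T -> A x ->
  exists z : X, [/\ A z, best_proximity_point A B T z &
    (fun n : nat => iter (2 * n) T x) @ \oo --> z].
Proof.
move=> AB cA cT Ax; have [TA TB [r [/andP[r0 r1] Tr]]] := cT.
have BTx : B (T x) by apply: TA; exists x.
pose u n := iter (2 * n) T x.
have Au n : A (u n) := (cyclic_contraction_even n x cT).1 Ax.
have orb := cyclic_contraction_orbit cT Ax.
(* The orbit estimate with [n = N] is uniform in [m >= N], so one point of [B] serves the whole
   tail. *)
have [|l ul] := AB u Au.
  move=> e e0; have [N HN] := orb e e0.
  exists (iter (2 * N) T (T x)).
    exact: (cyclic_contraction_even N (T x) cT).2.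
  by exists N => m; exact: HN.
(* WUC gives a limit in [X] only; convergence makes [u] Cauchy, and completeness then gives a limit
   in [A]. *)
have [z Az uz] : exists2 z, A z & u @ \oo --> z.
  apply: cA => //; apply: cauchy_exP => e e0; exists l.
  exact: ul (nbhsx_ballx _ _ e0).
exists z; split => //; split; first by left.
have BTz : B (T z) by apply: TA; exists z.
apply/eqP; rewrite eq_le set_dist_le // andbT; apply/ler_addgt0Pl => e e0.
have e3 : 0 < e / 3 by rewrite divr_gt0.
have [N HN] := orb _ e3.
have [M HM] := (cvg_mdistP _ _).1 uz _ e3.
(* With [v] the [2n]-th iterate of [T x], the excess of [(z, v)] is at most [2e/3] through [u n].
   The contraction carries this bound to [(T z, u n.+1)], and going from [u n.+1] to [z] costs the
   last [e / 3]. *)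
pose n := maxn N M.
have Bv : B (iter (2 * n) T (T x)) := (cyclic_contraction_even n (T x) cT).2 BTx.
have un : u n.+1 = T (iter (2 * n) T (T x)).
  by rewrite /u mulnS /= -iterSr.
have h1 := HN n n (leq_maxl _ _) (leqnn _).
have h2 := HM n (leq_maxr _ _).
have h3 := HM n.+1 (leqW (leq_maxr _ _)).
have h4 := metric_triangle z (u n) (iter (2 * n) T (T x)).
have h5 := Tr _ _ Az Bv; rewrite -un in h5.
have h6 := metric_triangle z (u n.+1) (T z).
rewrite (metric_sym (u n.+1)) in h6.
have h7 : r * (mdist z (iter (2 * n) T (T x)) - set_dist A B) <=
    r * (e / 3 + e / 3).
  by apply: ler_wpM2l; [exact: ltW | rewrite -/(u n) in h1; lra].
have h8 : r * (e / 3 + e / 3) <= e / 3 + e / 3 by apply: ler_piMl; lra.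
lra.
Qed.

(** A best proximity point [a] in [A] is fixed by [T] applied twice, since [a] and [T (T a)] are
    both at minimal distance from [T a]. Hence the excesses [s] of [(w, T w')] and [t] of
    [(w', T w)] satisfy [t <= r * s] and [s <= r * t], so [s <= 0]: both [w] and [w'] are at minimal
    distance from [T w']. *)
Lemma best_proximity_point_unique (R : realType) (X : metricType R)
    (A B : set X) (T : X -> X) (w w' : X) :
  property_WUC A B -> cyclic_contraction A B T ->
  A w -> best_proximity_point A B T w ->
  A w' -> best_proximity_point A B T w' -> w = w'.
Proof.
move=> AB cT; have [TA TB [r [/andP[r0 r1] Tr]]] := cT.
have BT a : A a -> B (T a) by move=> Aa; apply: TA; exists a.
have fixT a : A a -> best_proximity_point A B T a -> T (T a) = a.
  move=> Aa [_ aTa]; apply/esym/(property_WUC_unique AB Aa _ (BT _ Aa)).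
  - by apply: TB; exists (T a) => //; exact: BT.
  - by rewrite aTa.
  - by rewrite metric_sym (le_trans (Tr _ _ Aa (BT _ Aa))) // aTa; lra.
move=> Aw bw Aw' bw'.
have h1 := Tr _ _ Aw (BT _ Aw').
have h2 := Tr _ _ Aw' (BT _ Aw).
rewrite (fixT w') // metric_sym in h1.
rewrite (fixT w) // (metric_sym (T w')) in h2.
apply: (property_WUC_unique AB Aw Aw' (BT _ Aw')); last by rewrite bw'.2.
have h3 : r * (mdist w' (T w) - set_dist A B) <=
    r * (r * (mdist w (T w') - set_dist A B)) by apply: ler_wpM2l; lra.
have h4 : r * r < 1 by rewrite mulr_ilt1 // ltW.
rewrite -subr_le0 -(pmulr_rle0 _ (_ : 0 < 1 - r * r)); lra.
Qed.

Theorem theorem3p20 (R : realType) (X : metricType R) (A B : set X)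
    (T : {fun A `|` B >-> A `|` B}) :
  A !=set0 -> B !=set0 ->
  property_WUC A B ->
  complete_subset A ->
  cyclic_contraction A B T ->
  exists z : X,
    unique (fun w => A w /\ best_proximity_point A B T w) z /\
    forall x : X, A x -> (fun n : nat => iter (2 * n) T x) @ \oo --> z.
Proof.
move=> [a Aa] _ AB cA cT.
have [z [Az bz _]] := cyclic_contraction_cvg AB cA cT Aa.
exists z; split.
  split=> // w [Aw bw]; exact: best_proximity_point_unique AB cT Az bz Aw bw.
(* The limit of every orbit is itself a best proximity point in [A], so uniqueness identifies it
   with [z]. *)
move=> x Ax; have [w [Aw bw uw]] := cyclic_contraction_cvg AB cA cT Ax.
by rewrite (best_proximity_point_unique AB cT Az bz Aw bw).
Qed.
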